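(* If $a,b\in X$ are such that $a\sim b$, then $I(a)=I(b)$ for any iterated integral $I$.
   Context: Functions on the circle $S^1$ are identified with $2\pi$-periodic functions on $\mathbb{R}$. $X$ is the complex vector space of sequences $a=(a_1,a_2,\dots)$ with $a_i\in L^\infty(S^1)$ (complex-valued) for which there is $l>0$ (depending on $a$) with $\sup_{x\in S^1}|a_i(x)|\le l^i$ for all $i\ge1$ (sup understood as the $L^\infty$-norm). For $a,b\in X$: $a*b=(a_1*b_1,a_2*b_2,\dots)\in X$ and $a^{-1}=(a_1^{-1},a_2^{-1},\dots)\in X$, where $(a_i*b_i)(t)=2a_i(2t)$ for $0<t\le\pi$, $(a_i*b_i)(t)=2b_i(2t-2\pi)$ for $\pi<t\le2\pi$, and $a_i^{-1}(t)=-a_i(2\pi-t)$ for $0<t\le2\pi$ (extended $2\pi$-periodically). Basic iterated integrals on $X$: $I_{i_1,\dots,i_k}(a)=\int\cdots\int_{0\le s_1\le\cdots\le s_k\le2\pi}a_{i_k}(s_k)\cdots a_{i_1}(s_1)\,ds_k\cdots ds_1$ (equal to $1$ for $k=0$); iterated integrals are the elements of the complex linear span of the basic ones. The set of universal centers is $\mathcal{U}=\{a\in X: I_{i_1,\dots,i_k}(a)=0\text{ for all } k\ge1 \text{ and all positive integers } i_1,\dots,i_k\}$. The relation $a\sim b$ means $a*b^{-1}\in\mathcal{U}$. *)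

(* Defs.v *)
From mathcomp Require Import all_boot all_order all_algebra archimedean.
From mathcomp Require Import complex.
From mathcomp Require Import all_classical all_reals all_analysis ess_sup_inf.

Set Implicit Arguments.
Unset Strict Implicit.
Unset Printing Implicit Defensive.

Import Order.TTheory GRing.Theory Num.Theory.

Local Open Scope classical_set_scope.
Local Open Scope ring_scope.
Local Open Scope complex_scope.

Section CenterProblem.
Context {R : realType}.

Notation mu := (@lebesgue_measure R).
Notation twopi := (pi *+ 2 : R).

(* An element of L^oo(S^1) is handled through a 2pi-periodic Borel
   representative R -> R[i]; complex measurability is componentwise. *)
Definition circle_fun (f : R -> R[i]) : Prop :=
  [/\ periodic f twopi,
      measurable_fun setT (fun t => complex.Re (f t)) &
      measurable_fun setT (fun t => complex.Im (f t))].

(* By periodicity the essential supremum over R is that over S^1. *)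
Definition Loo_norm (f : R -> R[i]) : \bar R :=
  ess_sup mu (fun t => (ComplexField.Normc.normc (f t))%:E).

(* Sequences (a_1, a_2, ...) are functions on nat whose value at 0 is never
   used: every index below is required to be positive. *)
Definition coef_seq := nat -> R -> R[i].

Definition X : set coef_seq := [set a |
  (forall i, (0 < i)%N -> circle_fun (a i)) /\
  exists2 l : R, 0 < l &
    forall i, (0 < i)%N -> (Loo_norm (a i) <= (l ^+ i)%:E)%E].

(* The representative of t modulo 2pi in ]0, 2pi]. *)
Definition circle_rep (t : R) : R :=
  t - twopi * (Num.ceil (t / twopi) - 1)%:~R.

Definition periodic_ext (f : R -> R[i]) (t : R) : R[i] := f (circle_rep t).

Definition fun_mul (f g : R -> R[i]) : R -> R[i] :=
  periodic_ext (fun t =>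
    if t <= pi then 2 * f (2 * t) else 2 * g (2 * t - twopi)).

Definition fun_inv (f : R -> R[i]) : R -> R[i] :=
  periodic_ext (fun t => - f (twopi - t)).

Definition seq_mul (a b : coef_seq) : coef_seq := fun i => fun_mul (a i) (b i).

Definition seq_inv (a : coef_seq) : coef_seq := fun i => fun_inv (a i).

Definition cintegral (D : set R) (f : R -> R[i]) : R[i] :=
  (\int[mu]_(x in D) complex.Re (f x)) +i* (\int[mu]_(x in D) complex.Im (f x)).

(* For w = [:: j_1; ...; j_m], the integral
     int_{s}^{2pi} int_{s_1}^{2pi} ... int_{s_(m-1)}^{2pi}
       a_(j_m)(s_m) ... a_(j_1)(s_1) p  ds_m ... ds_1
   over s <= s_1 <= ... <= s_m <= 2pi; p accumulates the integrand. *)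
Fixpoint simplex_integral (a : coef_seq) (w : seq nat) (s : R) (p : R[i])
    : R[i] :=
  if w is j :: w' then
    cintegral `[s, twopi] (fun u => simplex_integral a w' u (a j u * p))
  else p.

Definition basic_integral (w : seq nat) (a : coef_seq) : R[i] :=
  simplex_integral a w 0 1.

Definition positive_word (w : seq nat) : bool := all (leq 1) w.

(* Membership, as a functional on X, in the complex linear span of the basic
   iterated integrals; the empty word gives the constant functional 1. *)
Definition iterated_integral (I : coef_seq -> R[i]) : Prop :=
  exists2 s : seq (R[i] * seq nat),
    all (fun cw => positive_word cw.2) s &
    forall a, X a -> I a = \sum_(cw <- s) cw.1 * basic_integral cw.2 a.

Definition universal_centers : set coef_seq := [set a |
  X a /\ forall w, w != [::] -> positive_word w -> basic_integral w a = 0].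

Definition center_equiv (a b : coef_seq) : Prop :=
  universal_centers (seq_mul a (seq_inv b)).

End CenterProblem.

Arguments coef_seq : clear implicits.

(* Main.v *)
Require Import Defs.
From mathcomp Require Import all_boot all_order all_algebra complex.
From mathcomp Require Import all_classical all_reals all_analysis.
From mathcomp Require Import measurable_realfun ess_sup_inf.
From mathcomp Require Import ring lra.

(* Let J_w(s, t) be the iterated integral over the oriented path from s to t,
   with no order assumed between s and t.  Additivity of the oriented integral
   gives Chen's identity J_w(s, t) = sum_(w = uv) J_u(s, r) J_v(r, t) for all
   r, s, t.  An affine change of variable identifies the two halves of
   a * b^-1 with the path of a from 0 to 2pi and the path of b from 2pi back
   to 0; hence, for every nonempty word w,
     sum_(w = uv) J^a_u(0, 2pi) J^b_v(2pi, 0) = 0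
       = J^b_w(0, 0) = sum_(w = uv) J^b_u(0, 2pi) J^b_v(2pi, 0),
   and J^a_w(0, 2pi) = J^b_w(0, 2pi) follows by induction on the length of w. *)

Set Implicit Arguments.
Unset Strict Implicit.
Unset Printing Implicit Defensive.

Import Order.TTheory GRing.Theory Num.Theory.
Import numFieldNormedType.Exports.

Local Open Scope classical_set_scope.
Local Open Scope ring_scope.

(** * Affine change of variable for the Lebesgue integral on the line *)

Section AffineSubstitution.
Context {R : realType}.
Notation mu := (@lebesgue_measure R).
Variables (k l : R).
Hypothesis k0 : k != 0.

Let phi (x : R) : R := k * x + l.

Let measurable_phi : measurable_fun setT (phi : R -> measurableTypeR R).
Proof. by apply: measurable_funD => //; exact: measurable_funM. Qed.

(** The image of [mu] under [phi], scaled by |k|, to be identified with [mu]. [Defined] lets its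
    values on sets unfold by conversion. *)
Let affine_measure : {measure set (measurableTypeR R) -> \bar R}.
Proof.
refine (mscale (NngNum (normr_ge0 k))
  (pushforward mu (phi : R -> measurableTypeR R))).
exact: measurable_phi.
Defined.

Lemma preimage_affine_gt0 (b0 b1 : bool) (a b : R) : 0 < k ->
  phi @^-1` [set` Interval (BSide b0 (phi a)) (BSide b1 (phi b))] =
  [set` Interval (BSide b0 a) (BSide b1 b)].
Proof.
move=> kgt0; apply/seteqP; split => x /=;
  by case: b0; case: b1; rewrite !in_itv/= /phi ?lerD2r ?ltrD2r
    ?ler_pM2l ?ltr_pM2l.
Qed.

(** A decreasing map exchanges the endpoints; a closed bound has flag [true] on the left and [false]
    on the right, so the exchanged flags are negated. *)
Lemma preimage_affine_lt0 (b0 b1 : bool) (a b : R) : k < 0 ->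
  phi @^-1` [set` Interval (BSide b0 (phi b)) (BSide b1 (phi a))] =
  [set` Interval (BSide (~~ b1) a) (BSide (~~ b0) b)].
Proof.
move=> klt0; apply/seteqP; split => x /=;
  by case: b0; case: b1; rewrite !in_itv/= /phi ?lerD2r ?ltrD2r
    ?ler_nM2l ?ltr_nM2l// andbC.
Qed.

(** By uniqueness of Lebesgue measure it is enough to compare both sides on intervals []a, b]]. *)
Lemma lebesgue_measure_affine (A : set R) : measurable A ->
  mu A = (`|k|%:E * mu (phi @^-1` A))%E.
Proof.
move=> mA.
rewrite [LHS](@lebesgue_measure_unique R affine_measure)// => _ [[a b]] _ <-.
transitivity (`|k|%:E * mu (phi @^-1` `]a, b]))%E; last by [].
(* [phi] is onto, so the endpoints can be written as values of [phi], as the preimage lemmas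
   require. *)
have phiK x : phi ((x - l) / k) = x by rewrite /phi; field.
rewrite -(phiK a) -(phiK b); move: (_ / k) (_ / k) => x y.
have [kgt0|klt0|/eqP] := ltrgt0P k; last by rewrite (negbTE k0).
- rewrite (preimage_affine_gt0 false false _ _ kgt0) !lebesgue_measure_itv/=.
  rewrite !lte_fin /phi ltrD2r ltr_pM2l//; case: ifP; rewrite ?mule0//.
  by rewrite -!EFinB -EFinM => _; congr EFin; ring.
- rewrite (preimage_affine_lt0 false false _ _ klt0) !lebesgue_measure_itv/=.
  rewrite !lte_fin /phi ltrD2r ltr_nM2l//; case: ifP; rewrite ?mule0//.
  by rewrite -!EFinB -EFinM => _; congr EFin; ring.
Qed.

Lemma ge0_integral_affine (D : set R) (f : R -> \bar R) : measurable D ->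
  measurable_fun D f -> (forall x, D x -> (0 <= f x)%E) ->
  (\int[mu]_(x in D) f x = `|k|%:E * \int[mu]_(x in phi @^-1` D) f (phi x))%E.
Proof.
move=> mD mf f0.
transitivity (\int[affine_measure]_(x in D) f x)%E.
  apply: eq_measure_integral => A mA _.
  exact: lebesgue_measure_affine.
rewrite ge0_integral_mscale// ge0_integral_pushforward//.
by move=> x; rewrite inE => /f0.
Qed.

Lemma integrable_affine (D : set R) (f : R -> R) : measurable D ->
  mu.-integrable D (EFin \o f) ->
  mu.-integrable (phi @^-1` D) (EFin \o (f \o phi)).
Proof.
move=> mD /integrableP[mf foo].
have kpos : 0 < `|k| by rewrite normr_gt0.
have mphiD : measurable (phi @^-1` D).
  by rewrite -[X in measurable X]setTI; exact: measurable_phi.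
have mfphi : measurable_fun (phi @^-1` D) (fun x => (f (phi x))%:E).
  apply: (measurable_comp (F := D) (f := EFin \o f) (g := phi)) => //.
    by move=> _ [x Dx <-].
  exact: measurable_funTS measurable_phi.
apply/integrableP; split=> //.
move: foo; rewrite ge0_integral_affine//; last exact: measurableT_comp.
(* An integral equal to [+oo] would remain so after multiplication by |k| > 0. *)
case: (\int[mu]_(x in _) _)%E => [r _||//]; first exact: ltry.
by rewrite gt0_muley ?lte_fin.
Qed.

Lemma Rintegral_affine (D : set R) (f : R -> R) : measurable D ->
  mu.-integrable D (EFin \o f) ->
  \int[mu]_(x in D) f x = \int[mu]_(x in phi @^-1` D) (`|k| * f (phi x)).
Proof.
move=> mD intf; have /integrableP[mf foo] := intf.
have mphiD : measurable (phi @^-1` D).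
  by rewrite -[X in measurable X]setTI; exact: measurable_phi.
have intfphi : mu.-integrable (phi @^-1` D) (fun x => (f (phi x))%:E).
  exact: integrable_affine.
have intE : (\int[mu]_(x in D) (f x)%:E =
    `|k|%:E * \int[mu]_(x in phi @^-1` D) (f (phi x))%:E)%E.
  rewrite [in LHS]integralE.
  rewrite (ge0_integral_affine mD (measurable_funepos mf))//.
  rewrite (ge0_integral_affine mD (measurable_funeneg mf))//.
  (* Factoring |k| out requires that the difference not be infinity minus infinity; the negative
     part has a finite integral. *)
  rewrite -muleBr//; last first.
    apply: fin_num_adde_defl; rewrite fin_numN.
    have := integrable_neg_fin_num _ intfphi.
    by rewrite (funeneg_comp (EFin \o f) phi); apply.
  congr (_ * _)%E; rewrite [RHS]integralE.
  by rewrite (funepos_comp (EFin \o f) phi) (funeneg_comp (EFin \o f) phi).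
rewrite RintegralZl// /Rintegral intE fineM//.
exact: integrable_fin_num.
Qed.
End AffineSubstitution.

(** * Oriented integrals of real functions *)

Section OrientedIntegral.
Context {R : realType}.
Notation mu := (@lebesgue_measure R).
Implicit Types (f g : R -> R) (r s t : R).

Definition segment_integrable f :=
  forall s t, mu.-integrable `[s, t] (EFin \o f).

(* At most one of the two intervals is nonempty; they are half-open like the
   pieces ]0, pi] and ]pi, 2pi] in the definition of the product. *)
Definition oint f s t : R :=
  \int[mu]_(x in `]s, t]) f x - \int[mu]_(x in `]t, s]) f x.

Lemma ointN f s t : oint f t s = - oint f s t.
Proof. by rewrite /oint opprB. Qed.

Lemma oint_le f s t : s <= t -> oint f s t = \int[mu]_(x in `]s, t]) f x.
Proof.
move=> st; rewrite /oint [in X in _ - X]set_itv_ge ?Rintegral_set0 ?subr0//.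
by rewrite bnd_simp -leNgt.
Qed.

Lemma segment_integrable_oc f s t : segment_integrable f ->
  mu.-integrable `]s, t] (EFin \o f).
Proof.
move=> /(_ s t); apply: integrableS => //.
by apply: subset_itvr; rewrite bnd_simp.
Qed.

Lemma eq_oint f g s t : s <= t -> {in `]s, t], f =1 g} ->
  oint f s t = oint g s t.
Proof.
move=> st fg; rewrite !oint_le//; apply: eq_Rintegral => x.
by rewrite inE => /fg.
Qed.

Let oint_cat_le f r s t : segment_integrable f -> s <= r -> r <= t ->
  oint f s t = oint f s r + oint f r t.
Proof.
move=> intf sr rt; rewrite !oint_le//; last exact: le_trans rt.
by rewrite -(@Rintegral_itvB _ f (BRight s) (BRight t) r) ?subrKC ?bnd_simp//;
  exact: segment_integrable_oc.
Qed.

(** Each of the six orders of [r], [s], [t] has its instance of the ordered case; antisymmetry turns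
    each into a linear relation between the same three integrals. *)
Lemma oint_cat f r s t : segment_integrable f ->
  oint f s t = oint f s r + oint f r t.
Proof.
move=> intf; have cat a b c := @oint_cat_le f a b c intf.
have := (cat r s t, cat s r t, cat r t s, cat t r s, cat s t r, cat t s r).
rewrite !(ointN f r t) !(ointN f s t) !(ointN f s r).
move=> [[[[[c1 c2] c3] c4] c5] c6].
have [sr|/ltW rs] := leP s r; have [rt|/ltW tr] := leP r t.
- exact: c1.
- by have [st|/ltW ts] := leP s t; [rewrite c6|move: (c5 ts sr)] => //; lra.
- by have [st|/ltW ts] := leP s t; [move: (c2 rs st)|move: (c4 rt ts)]; lra.
- by move: (c3 tr rs); lra.
Qed.

Lemma ointZr f k s t : segment_integrable f ->
  oint (fun u => f u * k) s t = oint f s t * k.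
Proof.
by move=> intf; rewrite /oint !RintegralZr ?mulrBl//;
  exact: segment_integrable_oc.
Qed.

Lemma segment_integrableD f g : segment_integrable f -> segment_integrable g ->
  segment_integrable (f \+ g).
Proof. by move=> intf intg s t; exact: integrableD (intf s t) (intg s t). Qed.

Lemma segment_integrableB f g : segment_integrable f -> segment_integrable g ->
  segment_integrable (f \- g).
Proof. by move=> intf intg s t; exact: integrableB (intf s t) (intg s t). Qed.

Lemma ointD f g s t : segment_integrable f -> segment_integrable g ->
  oint (fun u => f u + g u) s t = oint f s t + oint g s t.
Proof.
move=> intf intg; rewrite /oint !RintegralD//;
  do ?exact: segment_integrable_oc.
by rewrite opprD addrACA.
Qed.

(** Near [x] the variable [s] stays above [x - 1], so the function is a constant minus the integral
    from [x - 1] to [s], which is continuous in [s]. *)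
Lemma continuous_oint f t : segment_integrable f ->
  continuous (fun s => oint f s t).
Proof.
move=> intf x.
have xx : x - 1 < x + 1 by lra.
have := parameterized_integral_continuous (ltW xx) (intf (x - 1) (x + 1)).
move=> /(continuous_within_itvP _ xx)[+ _ _] => /(_ x).
rewrite in_itv/= => /(_ ltac:(lra)) cF.
have : {for x, continuous (fun s => oint f (x - 1) t -
    parameterized_integral mu (x - 1) s f)}.
  by apply: continuousB => //; exact: cst_continuous.
have nearE : \forall s \near x, oint f (x - 1) t -
    parameterized_integral mu (x - 1) s f = oint f s t.
  near=> s; rewrite (@oint_cat f s (x - 1) t intf) (@oint_le _ (x - 1) s).
    have := @Rintegral_itv_obnd_cbnd R (x - 1) (BRight s) f.
    move=> /(_ (segment_integrable_oc (x - 1) s intf)) ->.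
    by rewrite /parameterized_integral addrAC subrr add0r.
  by apply/ltW; near: s; apply: lt_nbhsr; lra.
rewrite /prop_for /continuous_at (nbhs_singleton nearE).
apply: cvg_trans; exact: near_eq_cvg.
Unshelve. all: by end_near.
Qed.

(** A continuous factor is bounded on a compact segment. *)
Lemma segment_integrableM f g : segment_integrable f -> continuous g ->
  segment_integrable (f \* g).
Proof.
move=> intf cg s t.
have -> : EFin \o (f \* g) = ((EFin \o g) \* (EFin \o f))%E.
  by apply/funext => x /=; rewrite mulrC EFinM.
apply: integrableMr => //.
  apply: measurable_funTS; exact: continuous_measurable_fun.
have : bounded_set (g @` `[s, t]).
  apply: compact_bounded; apply: continuous_compact.
    exact: continuous_subspaceT.
  exact: segment_compact.
move=> [M [Mreal gM]]; exists M; split=> // y /gM gy x xst.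
by apply: gy; exists x.
Qed.

(** The factor is [k] and not |k|: for [k < 0] the image interval is traversed backwards, and the
    orientation absorbs the sign. *)
Lemma oint_affine f (k l s t : R) : k != 0 -> segment_integrable f ->
  oint (fun u => k * f (k * u + l)) s t = oint f (k * s + l) (k * t + l).
Proof.
move=> k0 intf.
wlog st : s t / s <= t.
  move=> H; have [|/ltW ts] := leP s t; first exact: H.
  by rewrite ointN H// -ointN.
rewrite (oint_le _ st).
have intD D mD intDf := @Rintegral_affine R k l k0 D f mD intDf.
have [kgt0|klt0|/eqP] := ltrgtP 0 k; last by rewrite eq_sym (negbTE k0).
- rewrite oint_le; last by rewrite lerD2r ler_pM2l.
  rewrite intD//; last exact: segment_integrable_oc.
  by rewrite (@preimage_affine_gt0 R k l false false s t)// gtr0_norm.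
- rewrite ointN oint_le; last by rewrite lerD2r ler_nM2l.
  have intco : mu.-integrable `[k * t + l, k * s + l[ (EFin \o f).
    apply: integrableS (intf (k * t + l) (k * s + l)) => //.
    by apply: subset_itvl; rewrite bnd_simp.
  have intoo : mu.-integrable `]k * t + l, k * s + l[ (EFin \o f).
    apply: integrableS (intf (k * t + l) (k * s + l)) => //.
    by apply: subset_itv; rewrite bnd_simp.
  (* The interval closed on the left and open on the right is the one whose preimage under the
     decreasing map is []s, t]]; only null sets are changed. *)
  have -> : \int[mu]_(x in `]k * t + l, k * s + l]) f x =
      \int[mu]_(x in `[k * t + l, k * s + l[) f x.
    have <- := @Rintegral_itv_bndo_bndc R _ _ _ intoo.
    exact: (@Rintegral_itv_obnd_cbnd R _ _ _ intoo).
  rewrite intD// (@preimage_affine_lt0 R k l true true s t)// ltr0_norm//=.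
  have := @integrable_affine R k l k0 _ _ (measurable_itv _) intco.
  rewrite (@preimage_affine_lt0 R k l true true s t)//= => intg.
  have {}intg : mu.-integrable `]s, t] (EFin \o (fun x => f (k * x + l))).
    exact: intg.
  by rewrite !RintegralZl// mulNr opprK.
Qed.
End OrientedIntegral.

Local Open Scope complex_scope.

(** * Componentwise extension to complex-valued functions *)

Section ComplexOrientedIntegral.
Context {R : realType}.
Notation mu := (@lebesgue_measure R).
Implicit Types (f g : R -> R[i]) (r s t : R) (k : R[i]).

Lemma ReM (x y : R[i]) :
  complex.Re (x * y) =
  complex.Re x * complex.Re y - complex.Im x * complex.Im y.
Proof. by case: x; case: y. Qed.

Lemma ImM (x y : R[i]) :
  complex.Im (x * y) =
  complex.Re x * complex.Im y + complex.Im x * complex.Re y.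
Proof. by case: x; case: y. Qed.

Definition csegment_integrable f :=
  segment_integrable (fun u => complex.Re (f u)) /\
  segment_integrable (fun u => complex.Im (f u)).

Definition ccontinuous f :=
  continuous (fun u => complex.Re (f u)) /\
  continuous (fun u => complex.Im (f u)).

Definition cint f s t : R[i] :=
  oint (fun u => complex.Re (f u)) s t +i* oint (fun u => complex.Im (f u)) s t.

Lemma cint_cat f r s t : csegment_integrable f ->
  cint f s t = cint f s r + cint f r t.
Proof.
by move=> [ifr ifi]; rewrite /cint (oint_cat r s t ifr) (oint_cat r s t ifi).
Qed.

Lemma eq_cint f g s t : s <= t -> {in `]s, t], f =1 g} ->
  cint f s t = cint g s t.
Proof.
by move=> st fg; rewrite /cint; congr (_ +i* _); apply: eq_oint => // u /fg ->.
Qed.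

Lemma ccontinuous_cint f t : csegment_integrable f ->
  ccontinuous (fun s => cint f s t).
Proof. by move=> [ifr ifi]; split; exact: continuous_oint. Qed.

Lemma ccontinuous_cst k : ccontinuous (fun=> k).
Proof. by split; exact: cst_continuous. Qed.

Lemma csegment_integrableM f g : csegment_integrable f -> ccontinuous g ->
  csegment_integrable (fun u => f u * g u).
Proof.
move=> [ifr ifi] [cgr cgi]; split.
- rewrite (_ : (fun u => _) =
    (fun u => complex.Re (f u)) \* (fun u => complex.Re (g u))
    \- (fun u => complex.Im (f u)) \* (fun u => complex.Im (g u))).
    by apply: segment_integrableB; exact: segment_integrableM.
  by apply/funext => u; rewrite ReM.
- rewrite (_ : (fun u => _) =
    (fun u => complex.Re (f u)) \* (fun u => complex.Im (g u))
    \+ (fun u => complex.Im (f u)) \* (fun u => complex.Re (g u))).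
    by apply: segment_integrableD; exact: segment_integrableM.
  by apply/funext => u; rewrite ImM.
Qed.

Lemma cintZr f k s t : csegment_integrable f ->
  cint (fun u => f u * k) s t = cint f s t * k.
Proof.
move=> [ifr ifi].
have cstM (h : R -> R) c : segment_integrable h ->
  segment_integrable (fun u => h u * c).
  by move=> /segment_integrableM; apply; exact: cst_continuous.
rewrite /cint; case: k => a b; congr (_ +i* _).
- under [fun u => complex.Re _]eq_fun do rewrite ReM/= -mulrN.
  by rewrite ointD ?ointZr ?mulrN//; exact: cstM.
- under [fun u => complex.Im _]eq_fun do rewrite ImM/=.
  by rewrite ointD ?ointZr//; exact: cstM.
Qed.

Lemma csegment_integrableD f g : csegment_integrable f ->
  csegment_integrable g -> csegment_integrable (fun u => f u + g u).
Proof.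
move=> [ifr ifi] [igr igi]; split.
- rewrite (_ : (fun u => _) =
    (fun u => complex.Re (f u)) \+ (fun u => complex.Re (g u))).
    exact: segment_integrableD.
  by apply/funext => u /=; case: (f u); case: (g u).
- rewrite (_ : (fun u => _) =
    (fun u => complex.Im (f u)) \+ (fun u => complex.Im (g u))).
    exact: segment_integrableD.
  by apply/funext => u /=; case: (f u); case: (g u).
Qed.

Lemma cintD f g s t : csegment_integrable f -> csegment_integrable g ->
  cint (fun u => f u + g u) s t = cint f s t + cint g s t.
Proof.
move=> [ifr ifi] [igr igi]; rewrite /cint; apply/eqP; rewrite eq_complex /=.
rewrite -!ointD//; apply/andP; split; apply/eqP; congr (oint _ s t);
  by apply/funext => u; case: (f u); case: (g u).
Qed.

(** The two conclusions are proved together, since additivity at the next step requires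
    integrability of the partial sum. *)
Lemma cint_sum (n : nat) (F : nat -> R -> R[i]) s t :
  (forall i, (i <= n)%N -> csegment_integrable (F i)) ->
  csegment_integrable (fun u => \sum_(i < n.+1) F i u) /\
  cint (fun u => \sum_(i < n.+1) F i u) s t = \sum_(i < n.+1) cint (F i) s t.
Proof.
elim: n => [|n IHn] iF.
  rewrite big_ord1; under eq_fun do rewrite big_ord1.
  by split=> //; exact: iF.
have [|iS cS] := IHn; first by move=> i ilen; exact/iF/leqW.
rewrite big_ord_recr/= -cS; under eq_fun do rewrite big_ord_recr/=.
split; first exact: csegment_integrableD (iF _ (leqnn _)).
by rewrite cintD//; exact: iF.
Qed.

Lemma cint_affine f (k l s t : R) : k != 0 -> csegment_integrable f ->
  cint (fun u => k%:C * f (k * u + l)) s t = cint f (k * s + l) (k * t + l).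
Proof.
move=> k0 [ifr ifi]; rewrite /cint; congr (_ +i* _).
- rewrite -oint_affine//; congr (oint _ s t); apply/funext => u.
  by rewrite ReM/= mul0r subr0.
- rewrite -oint_affine//; congr (oint _ s t); apply/funext => u.
  by rewrite ImM/= mul0r addr0.
Qed.

Lemma eq_cintegral f g (D : set R) : {in D, f =1 g} ->
  cintegral D f = cintegral D g.
Proof.
by move=> fg; rewrite /cintegral; congr (_ +i* _);
  apply: eq_Rintegral => u /fg ->.
Qed.

Lemma cintegral_itvcc f s t : csegment_integrable f -> s <= t ->
  cintegral `[s, t] f = cint f s t.
Proof.
move=> [ifr ifi] st; rewrite /cint !oint_le// /cintegral; congr (_ +i* _).
- exact/esym/(@Rintegral_itv_obnd_cbnd R s (BRight t))/segment_integrable_oc.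
- exact/esym/(@Rintegral_itv_obnd_cbnd R s (BRight t))/segment_integrable_oc.
Qed.

End ComplexOrientedIntegral.

(** * Iterated integrals along oriented paths and Chen's identity *)

Section OrientedIteratedIntegral.
Context {R : realType}.
Implicit Types (a c : coef_seq R) (w : seq nat) (r s t : R).

(** Unlike in [simplex_integral], the factor [a j u] stays outside the inner integral, which is then
    a function of its endpoints and can be cut and shown continuous. *)
Fixpoint iterated_oint a w s t : R[i] :=
  if w is j :: w' then cint (fun u => a j u * iterated_oint a w' u t) s t
  else 1.

Definition locally_integrable_seq a :=
  forall j, (0 < j)%N -> csegment_integrable (a j).

(** Continuity in the lower endpoint makes the next integrand integrable, as a locally integrable
    function times a continuous one. *)
Lemma ccontinuous_iterated_oint a w t : locally_integrable_seq a ->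
  positive_word w -> ccontinuous (fun s => iterated_oint a w s t).
Proof.
move=> ia; elim: w => [_|j w IHw /= /andP[j0 pw]].
  exact: ccontinuous_cst.
by apply: ccontinuous_cint; apply: csegment_integrableM (IHw pw); exact: ia.
Qed.

Lemma csegment_integrable_iterated_oint a j w t : locally_integrable_seq a ->
  positive_word (j :: w) ->
  csegment_integrable (fun u => a j u * iterated_oint a w u t).
Proof.
move=> ia /andP[j0 pw].
by apply: csegment_integrableM; [exact: ia|exact: ccontinuous_iterated_oint].
Qed.

Lemma positive_word_take k w : positive_word w -> positive_word (take k w).
Proof. by move=> /allP pw; apply/allP => j /mem_take /pw. Qed.

Lemma positive_word_drop k w : positive_word w -> positive_word (drop k w).
Proof. by move=> /allP pw; apply/allP => j /mem_drop /pw. Qed.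

(** Cut the outermost integral at [r]. The part from [r] to [t] is the term with empty prefix; on
    the part from [s] to [r] the induction hypothesis cuts the inner integral at [r] too, and the
    suffix factors do not depend on [u]. *)
Lemma iterated_oint_cat a w r s t : locally_integrable_seq a ->
  positive_word w ->
  iterated_oint a w s t = \sum_(k < (size w).+1)
    iterated_oint a (take k w) s r * iterated_oint a (drop k w) r t.
Proof.
move=> ia; elim: w s => [|j w IHw] s; first by rewrite big_ord1 mulr1.
move=> /[dup] pjw /andP[j0 pw].
rewrite big_ord_recl/= mul1r (cint_cat r)//; last first.
  exact: csegment_integrable_iterated_oint.
rewrite addrC; congr (_ + _).
under [X in cint X _ _]eq_fun do rewrite (IHw _ pw) mulr_sumr.
have iF k : (k <= size w)%N -> csegment_integrable (fun u =>
    a j u * iterated_oint a (take k w) u r).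
  move=> _; apply: csegment_integrable_iterated_oint => //=.
  by rewrite j0; exact: positive_word_take.
have := @cint_sum _ (size w) (fun k u => a j u *
  (iterated_oint a (take k w) u r * iterated_oint a (drop k w) r t)) s r.
case.
  move=> k kw; under eq_fun do rewrite mulrA.
  by apply: csegment_integrableM (iF k kw) _; exact: ccontinuous_cst.
move=> _ ->; apply: eq_bigr => k _.
under [X in cint X _ _]eq_fun do rewrite mulrA.
by rewrite cintZr//; apply: iF; rewrite -ltnS.
Qed.

Lemma iterated_oint_id a w s : w != [::] -> iterated_oint a w s s = 0.
Proof.
by case: w => // j w _ /=; rewrite /cint /oint !subrr.
Qed.

(** Each letter supplies one factor [k], the Jacobian of its variable. The window []s0, t0]] stays
    fixed while the induction moves [s]. *)
Lemma iterated_oint_affine a c w (k l s t s0 t0 : R) : k != 0 ->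
  locally_integrable_seq a -> positive_word w ->
  (forall j u, (0 < j)%N -> u \in `]s0, t0] ->
     c j u = k%:C * a j (k * u + l)) ->
  s0 <= s -> s <= t -> t <= t0 ->
  iterated_oint c w s t = iterated_oint a w (k * s + l) (k * t + l).
Proof.
move=> k0 ia pw ca s0s st tt0.
elim: w s s0s st pw => // j w IHw s s0s st /= /andP[j0 pw].
rewrite -cint_affine//; last first.
  by apply: csegment_integrable_iterated_oint => //; exact/andP.
apply: eq_cint => // u; rewrite in_itv/= => /andP[su ut].
rewrite ca// ?in_itv/= ?(le_lt_trans s0s su) ?(le_trans ut tt0)//.
by rewrite -mulrA IHw ?(le_trans s0s (ltW su)).
Qed.

(** The accumulator only enters as a factor, so it can be pulled out; the bound on [s] makes each
    integral over a closed interval an oriented one. *)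
Lemma simplex_integralE a w s (p : R[i]) : locally_integrable_seq a ->
  positive_word w -> s <= pi *+ 2 ->
  simplex_integral a w s p = iterated_oint a w s (pi *+ 2) * p.
Proof.
move=> ia; elim: w s p => [|j w IHw] s p; first by rewrite mul1r.
move=> /[dup] pjw /andP[j0 pw] s2 /=.
rewrite -cintZr; last exact: csegment_integrable_iterated_oint.
rewrite -cintegral_itvcc//; last first.
  apply: csegment_integrableM; last exact: ccontinuous_cst.
  exact: csegment_integrable_iterated_oint.
apply: eq_cintegral => u; rewrite inE/= in_itv/= => /andP[_ u2].
by rewrite IHw// mulrA [_ * a j u]mulrC mulrAC.
Qed.

End OrientedIteratedIntegral.

(** * Sequences in [X], the two halves of the product, and the cancellation *)

Section CircleSequences.
Context {R : realType}.
Notation mu := (@lebesgue_measure R).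
Implicit Types (a b : coef_seq R).

Lemma ae_bounded_segment_integrable (f : R -> R) (M : R) :
  measurable_fun setT f -> (\forall x \ae mu, `|f x| <= M) ->
  segment_integrable f.
Proof.
move=> mf fM s t.
have mfst : measurable_fun `[s, t] (EFin \o f).
  by apply/measurable_EFinP; exact: measurable_funTS.
apply/integrableP; split=> //.
(* Comparison with a constant on a segment of finite measure; |M| makes that constant
   nonnegative. *)
apply: (@le_lt_trans _ _ (\int[mu]_(x in `[s, t]) (`|M|%:E))%E).
  apply: ae_ge0_le_integral => //.
  - exact: measurableT_comp.
  - apply: (@filterS _ _ (ae_filter_ringOfSetsType mu)) fM => x fxM _ /=.
    by rewrite lee_fin (le_trans fxM)// ler_norm.
have muoo : (mu `[s, t] < +oo)%E.
  rewrite lebesgue_measure_itv/= lte_fin.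
  by case: ifP => _; rewrite -?EFinB ltry.
by rewrite integral_cst// lte_mul_pinfty.
Qed.

Lemma Re_le_normc (z : R[i]) : `|complex.Re z| <= ComplexField.Normc.normc z.
Proof.
by case: z => x y /=; rewrite -sqrtr_sqr ler_wsqrtr// lerDl sqr_ge0//.
Qed.

Lemma Im_le_normc (z : R[i]) : `|complex.Im z| <= ComplexField.Normc.normc z.
Proof.
by case: z => x y /=; rewrite -sqrtr_sqr ler_wsqrtr// lerDr sqr_ge0//.
Qed.

Lemma X_locally_integrable a : X a -> locally_integrable_seq a.
Proof.
move=> [ca [l _ la]] j j0; have [_ mre mim] := ca j j0.
have /ess_supP bnd := la j j0.
split; apply: (@ae_bounded_segment_integrable _ (l ^+ j)) => //.
- apply: (@filterS _ _ (ae_filter_ringOfSetsType mu)) bnd => x.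
  by rewrite lee_fin; exact/le_trans/Re_le_normc.
- apply: (@filterS _ _ (ae_filter_ringOfSetsType mu)) bnd => x.
  by rewrite lee_fin; exact/le_trans/Im_le_normc.
Qed.

Lemma circle_rep_id (t : R) : 0 < t -> t <= pi *+ 2 -> circle_rep t = t.
Proof.
(* The quotient of [t] by the period lies in []0, 1]], so its ceiling is 1 and no period is
   removed. *)
move=> t0 t2; rewrite /circle_rep (_ : Num.ceil _ = 1) ?subrr ?mulr0 ?subr0//.
have p2 : 0 < pi *+ 2 :> R by rewrite mulrn_wgt0// pi_gt0.
by apply: ceil_def; rewrite subrr divr_gt0//= ler_pdivrMr// mul1r.
Qed.

(** The [+ 0] gives the shape [k * u + l] expected by [iterated_oint_affine]. *)
Lemma seq_mul_fst a b j (u : R) : 0 < u -> u <= pi ->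
  seq_mul a b j u = 2%:C * a j (2 * u + 0).
Proof.
move=> u0 upi; have := pi_gt0 R => pi0.
rewrite /seq_mul /fun_mul /periodic_ext circle_rep_id//; last by lra.
by rewrite upi addr0 rmorph_nat.
Qed.

Lemma seq_mul_inv_snd a b j (u : R) : pi < u -> u <= pi *+ 2 ->
  seq_mul a (seq_inv b) j u = (- 2)%:C * b j (- 2 * u + pi *+ 4).
Proof.
move=> upi u2; have := pi_gt0 R => pi0.
rewrite /seq_mul /fun_mul /periodic_ext circle_rep_id//; last by lra.
(* The inverse is taken at [2 * u - pi *+ 2], again in []0, pi *+ 2]]; its reflection is
   [- 2 * u + pi *+ 4]. *)
rewrite leNgt upi/= /seq_inv /fun_inv /periodic_ext circle_rep_id; [|lra..].
rewrite mulrN rmorphN rmorph_nat [RHS]mulNr; congr (- (_ * b j _)); lra.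
Qed.

Lemma center_equiv_basic_integral a b w :
  X a -> X b -> center_equiv a b ->
  positive_word w -> basic_integral w a = basic_integral w b.
Proof.
move=> Xa Xb [Xc c0]; set c := seq_mul _ _ in Xc c0.
have ia := X_locally_integrable Xa; have ib := X_locally_integrable Xb.
have ic := X_locally_integrable Xc.
have pi0 := pi_gt0 R.
have twopi0 : 0 <= pi *+ 2 :> R by lra.
(* Strong induction on the length, since proper prefixes of every length occur. *)
have [n] := ubnP (size w); elim: n w => // n IHn w wn pw.
have [-> //|w0] := eqVneq w [::].
have basicE (d : coef_seq R) : locally_integrable_seq d ->
    forall v, positive_word v ->
    basic_integral v d = iterated_oint d v 0 (pi *+ 2).
  by move=> id v pv; rewrite /basic_integral simplex_integralE ?mulr1.
have abE : \sum_(k < (size w).+1) iterated_oint a (take k w) 0 (pi *+ 2) *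
    iterated_oint b (drop k w) (pi *+ 2) 0 = 0.
  transitivity (basic_integral w c); last exact: c0.
  (* The cut is at [pi], where the product passes from [a] to the inverse of [b]. *)
  rewrite basicE// (iterated_oint_cat pi _ _ ic pw).
  apply: eq_bigr => k _; congr (_ * _).
  - rewrite (@iterated_oint_affine _ a c _ 2 0 0 pi 0 pi)//.
    + by rewrite mulr0 addr0 addr0 mulr_natl.
    + exact: positive_word_take.
    + by move=> j u _; rewrite in_itv/= => /andP[? ?]; exact: seq_mul_fst.
    + lra.
  (* The map [- 2 * u + pi *+ 4] sends [pi] to [pi *+ 2] and [pi *+ 2] to 0. *)
  - rewrite (@iterated_oint_affine _ b c _ (- 2) (pi *+ 4) pi (pi *+ 2)
      pi (pi *+ 2))//.
    + by congr iterated_oint; lra.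
    + exact: positive_word_drop.
    + by move=> j u _; rewrite in_itv/= => /andP[? ?]; exact: seq_mul_inv_snd.
    + lra.
have bbE : \sum_(k < (size w).+1) iterated_oint b (take k w) 0 (pi *+ 2) *
    iterated_oint b (drop k w) (pi *+ 2) 0 = 0.
  by rewrite -iterated_oint_cat// iterated_oint_id.
(* The last term pairs all of [w] with the empty suffix, of value 1. The other terms involve proper
   prefixes, where [a] and [b] agree by induction, and cancel. *)
have := etrans abE (esym bbE); rewrite !big_ord_recr/=.
rewrite take_size drop_size/= !mulr1.
rewrite !basicE// (eq_bigr (fun k : 'I_(size w) =>
  iterated_oint b (take k w) 0 (pi *+ 2) *
  iterated_oint b (drop k w) (pi *+ 2) 0)); first exact: addrI.
move=> k _; congr (_ * _); rewrite -!basicE ?positive_word_take//.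
apply: IHn; last exact: positive_word_take.
by rewrite size_take ltn_ord (leq_trans (ltn_ord k)).
Qed.

End CircleSequences.

Theorem proposition3p3 (R : realType) (a b : coef_seq R)
  (Xa : X a) (Xb : X b) (ab : center_equiv a b)
  (I : coef_seq R -> complex R) (itI : iterated_integral I) :
  I a = I b.
Proof.
case: itI => s /allP ps IE; rewrite !IE//.
(* [big_seq] retains membership in [s], from which each word is known to be positive. *)
rewrite big_seq [RHS]big_seq; apply: eq_bigr => cw /ps pcw.
by congr (_ * _); exact: center_equiv_basic_integral.
Qed.
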